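(* Let $X$ be a completely regular space and let $H$ be a non-vanishing closed ideal in $C_B(X)$. The following are equivalent: (1) $\mathfrak{sp}(H)$ is $\sigma$-compact. (2) $H$ is $\sigma$-generated, that is, $H=\overline{\langle f_1,f_2,\ldots\rangle}$ for some $f_1,f_2,\ldots$ in $C_B(X)$.
   Context: Completely regular spaces are assumed to be Hausdorff. $C_B(X)$ is the normed algebra of continuous bounded $f:X\to\mathbb{C}$ with the supremum norm; the bar denotes closure in $C_B(X)$, and $\langle f_1,f_2,\ldots\rangle$ is the ideal of $C_B(X)$ generated by $f_1,f_2,\ldots$. An ideal $H$ of $C_B(X)$ is non-vanishing if for every $x\in X$ there is $h\in H$ with $h(x)\neq0$. $\mathfrak{sp}(H)$ is the Gelfand spectrum of the commutative $C^*$-algebra $H$; it is identified with the subspace $\bigcup_{h\in H}\mathrm{cl}_{\beta X}|h|^{-1}((1,\infty))$ of the Stone–Čech compactification $\beta X$. *)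

(* Defs.v *)
From HB Require Import structures.
From mathcomp Require Import all_boot all_order all_algebra complex.
From mathcomp Require Import all_classical all_reals all_analysis.

Set Implicit Arguments.
Unset Strict Implicit.
Unset Printing Implicit Defensive.

Import Order.TTheory GRing.Theory Num.Theory Normc.
Import numFieldNormedType.Exports.

Local Open Scope classical_set_scope.
Local Open Scope ring_scope.
Local Open Scope complex_scope.

(* The canonical topology of a numClosedFieldType is not inferred on the
   concrete type R[i]; this is the metric topology of the modulus. *)
HB.instance Definition _ (R : rcfType) := PseudoPointedMetric.copy R[i] R[i]^o.
HB.instance Definition _ (R : rcfType) := NormedModule.copy R[i] R[i]^o.

Section BoundedContinuous.
Context (R : realType) (X : topologicalType).

Definition bounded_continuous : {pred X -> R[i]} :=
  mem [set f : X -> R[i] | continuous f /\ bounded_fun f].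

Record CB := MkCB {
  CB_val :> X -> R[i];
  _ : CB_val \in bounded_continuous
}.

HB.instance Definition _ := [isSub for CB_val].
HB.instance Definition _ := [Choice of CB by <:].

Lemma bounded_funcP (f : X -> R[i]) :
  bounded_fun f <-> exists M : R, forall x, normc (f x) <= M.
Proof.
split=> [[M [Mreal Mf]]|[M fM]].
  have /complex_realP[m Mm] := Mreal.
  exists (m + 1) => x; rewrite -lecR; apply: (Mf (m + 1)%:C) => //.
  by rewrite Mm ltcR ltrDl.
exists M%:C; split; first by apply/complex_realP; exists M.
move=> N MN x _ /=; apply: le_trans (ltW MN).
by change ((normc (f x))%:C <= M%:C); rewrite lecR.
Qed.

Lemma normc_ge0 (z : R[i]) : 0 <= normc z.
Proof. by case: z => a b; exact: sqrtr_ge0. Qed.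

Lemma bounded_continuous_submod : submod_closed bounded_continuous.
Proof.
split=> [|a f g].
  rewrite inE; split; first exact: cst_continuous.
  by apply/bounded_funcP; exists 0 => x; rewrite normc0.
rewrite !inE => -[cf /bounded_funcP[M fM]] [cg /bounded_funcP[N gN]].
split.
  move=> x; apply: continuousD; last exact: cg.
  by apply: (@continuousM _ _ (cst a) f); [exact: cst_continuous | exact: cf].
apply/bounded_funcP; exists (normc a * M + N) => x.
apply: (le_trans (le_normcD _ _)); apply: lerD => //.
change (normc (a * f x) <= normc a * M).
by rewrite normcM ler_wpM2l ?normc_ge0.
Qed.

Lemma bounded_continuous_subring : subring_closed bounded_continuous.
Proof.
have [b0 bD] := bounded_continuous_submod.
split=> [|f g fb gb|f g].
- rewrite inE; split; first exact: cst_continuous.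
  by apply/bounded_funcP; exists 1 => x; rewrite normc1.
- have -> : f - g = (-1) *: g + f by rewrite scaleN1r addrC.
  exact: bD.
rewrite !inE => -[cf /bounded_funcP[M fM]] [cg /bounded_funcP[N gN]].
split.
  by move=> x; apply: (@continuousM _ _ f g); [exact: cf | exact: cg].
apply/bounded_funcP; exists (M * N) => x.
rewrite [X in normc X](_ : _ = f x * g x)// normcM.
by apply: ler_pM; rewrite ?normc_ge0.
Qed.

Lemma bounded_continuous_scale : scaler_closed bounded_continuous.
Proof.
have [b0 bD] := bounded_continuous_submod.
by move=> a f fb; rewrite -[_ *: _]addr0; exact: bD.
Qed.

HB.instance Definition _ :=
  GRing.isSubringClosed.Build _ bounded_continuous bounded_continuous_subring.
HB.instance Definition _ :=
  GRing.isScaleClosed.Build _ _ bounded_continuous bounded_continuous_scale.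
HB.instance Definition _ :=
  GRing.SubChoice_isSubComPzRing.Build _ _ CB bounded_continuous_subring.
HB.instance Definition _ := [SubZmodule_isSubLmodule of CB by <:].

(* If X is empty this is sup set0 = 0, as it should be. *)
Definition supnorm (f : CB) : R := sup (range (fun x => normc (f x))).

Lemma supnorm_ub (f : CB) x : normc (f x) <= supnorm f.
Proof.
have /set_mem[_ /bounded_funcP[M fM]] := valP f.
by apply: ub_le_sup; [exists M => _ [y _ <-] | exists x].
Qed.

Lemma supnorm_le (f : CB) (M : R) :
  0 <= M -> (forall x, normc (f x) <= M) -> supnorm f <= M.
Proof.
move=> M0 fM; rewrite /supnorm.
have [->|ne] := eqVneq (range (fun x => normc (f x))) set0; first by rewrite sup0.
by apply: ge_sup; [exact/set0P | move=> _ [x _ <-]].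
Qed.

Lemma supnorm_ge0 (f : CB) : 0 <= supnorm f.
Proof.
have [ne|] := pselect (exists x : X, True).
  by case: ne => x _; exact: le_trans (normc_ge0 (f x)) (supnorm_ub f x).
move=> /forallNP nX; rewrite /supnorm [X in sup X](_ : _ = set0) ?sup0//.
by rewrite -subset0 => r [x _ _]; have := nX x; apply.
Qed.

Let cnorm (f : CB) : R[i] := (supnorm f)%:C.

Let cnormD f g : cnorm (f + g) <= cnorm f + cnorm g.
Proof.
rewrite -rmorphD lecR; apply: supnorm_le => [|x].
  by rewrite addr_ge0// supnorm_ge0.
by apply: le_trans (le_normcD _ _) _; apply: lerD; exact: supnorm_ub.
Qed.

Let cnormZ_le (a : R[i]) f : supnorm (a *: f) <= normc a * supnorm f.
Proof.
apply: supnorm_le => [|x]; first by rewrite mulr_ge0 ?normc_ge0 ?supnorm_ge0.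
rewrite [X in normc X](_ : _ = a * f x)// normcM.
by rewrite ler_wpM2l ?normc_ge0 ?supnorm_ub.
Qed.

Let cnormZ (a : R[i]) f : cnorm (a *: f) = `|a| * cnorm f.
Proof.
rewrite (_ : `|a| = (normc a)%:C)// -rmorphM; congr (_%:C).
apply/eqP; rewrite eq_le cnormZ_le/=.
have [->|a0] := eqVneq a 0; first by rewrite normc0 mul0r supnorm_ge0.
have na : 0 < normc a.
  rewrite lt_def normc_ge0 andbT.
  by apply: contra_neq a0; exact: eq0_normc.
rewrite -ler_pdivlMl// -normcV -[X in supnorm X <= _](scalerK a0).
by rewrite cnormZ_le.
Qed.

Let cnorm_eq0 f : cnorm f = 0 -> f = 0.
Proof.
move=> [f0]; apply/val_inj/funext => x; apply: eq0_normc.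
by apply/eqP; rewrite eq_le normc_ge0 andbT -f0 supnorm_ub.
Qed.

(* The norm of a normedModType over R[i] takes its values in R[i]. *)
HB.instance Definition _ :=
  Lmodule_isNormed.Build R[i] CB cnormD cnormZ cnorm_eq0.

Lemma CB_normE (f : CB) : `|f| = (supnorm f)%:C.
Proof. by []. Qed.

End BoundedContinuous.

Section Ideals.
Context (R : realType) (X : topologicalType).
Local Notation CBX := (CB R X).

(* Ideals need not be proper: H may be the whole algebra. *)
Definition ideal (I : set CBX) :=
  [/\ I 0,
      forall f g, I f -> I g -> I (f + g) &
      forall a f, I f -> I (a * f)].

Definition ideal_generated (G : set CBX) : set CBX := smallest ideal G.

Definition non_vanishing (H : set CBX) :=
  forall x : X, exists2 h : CBX, H h & h x != 0.

Definition sigma_generated (H : set CBX) :=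
  exists f : nat -> CBX, H = closure (ideal_generated (range f)).

(* The Gelfand spectrum: nonzero multiplicative linear functionals on H, with
   the topology of pointwise convergence on H (the weak* topology).  The
   operations of H are those of the ambient algebra; H is a mere set, so they
   are spelled out relationally. *)
Definition gelfand_spectrum (H : set CBX) : set {ptws H -> R[i]} :=
  [set chi |
    [/\ forall f g h : H, \val h = \val f + \val g -> chi h = chi f + chi g,
        forall (a : R[i]) (f h : H), \val h = a *: \val f -> chi h = a * chi f,
        forall f g h : H, \val h = \val f * \val g -> chi h = chi f * chi g &
        exists h : H, chi h != 0]].

End Ideals.
Arguments gelfand_spectrum {R X} H.

(* Compactness of a subset is intrinsic to its subspace topology, so this says
   that the subspace A is a sigma-compact space. *)
Definition sigma_compact (T : topologicalType) (A : set T) :=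
  exists2 K : nat -> set T, (forall n, compact (K n)) & A = \bigcup_n K n.

(* Main.v *)
(* A character of H satisfies |chi f| <= |f| (otherwise 1 - f / chi f is
   invertible), so the characters bounded away from 0 at a given f in H form a
   compact set, by Tychonoff.  If H is the closed ideal generated by f_0, f_1, ...,
   no character kills all the f_n, because the kernel of a character is a closed
   ideal of C_B(X); this exhibits the spectrum as a countable union of compacts.
   Conversely, finite subcovers of the pieces of a sigma-compact spectrum by the
   open sets {chi | chi h != 0} provide a sequence h_0, h_1, ... in H without
   common zero on the spectrum.  Given f in H and e > 0, some finite sum
   g = sum_{i<k} |h_i|^2 is then bounded below on {|f| >= e}: otherwise the point
   evaluations where |f| >= e and |h_0|, ..., |h_(k-1)| <= 1/(k+1) would accumulate
   at a character killing all the h_i.  Hence f is approximated by f g / (g + eta). *)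
Require Import Defs.
From mathcomp Require Import all_boot all_order all_algebra complex.
From mathcomp Require Import all_classical all_reals all_analysis.
Import numFieldNormedType.Exports.
From mathcomp Require Import ring lra.

Set Implicit Arguments.
Unset Strict Implicit.
Unset Printing Implicit Defensive.

Import Order.TTheory GRing.Theory Num.Theory Normc.
Local Open Scope classical_set_scope.
Local Open Scope ring_scope.
Local Open Scope complex_scope.

(** * Compactness and closedness in general topological spaces *)

(** The traces of the [C i] on [K] form the base of a proper filter. A cluster point of it in [K]
    lies in each [C i] by closedness. *)
Lemma compact_closed_directed (T : topologicalType) (I : Type) (K : set T)
    (C : I -> set T) (i0 : I) :
  compact K -> (forall i, closed (C i)) ->
  (forall i j, exists k, C k `<=` C i `&` C j) ->
  (forall i, K `&` C i !=set0) -> exists2 t, K t & forall i, C i t.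
Proof.
move=> Kc Ccl Cdir KC.
pose F := filter_from setT (fun i => K `&` C i).
have FF : ProperFilter F.
  apply: filter_from_proper => [|i _]; last exact: KC.
  apply: filter_from_filter => [|i j _ _]; first by exists i0.
  by have [k kij] := Cdir i j; exists k => // t [Kt /kij[]].
have FK : F K by exists i0 => // t [].
have [t [Kt Ft]] := Kc F FF FK.
exists t => // i; apply: Ccl => B tB.
by have [|s [[_ Cs] Bs]] := Ft (K `&` C i) B _ tB; [exists i | exists s].
Qed.

Lemma closed_forall (T : topologicalType) (I : Type) (A : I -> set T) :
  (forall i, closed (A i)) -> closed [set t | forall i, A i t].
Proof.
move=> Acl; have -> : [set t | forall i, A i t] = \bigcap_i A i.
  by apply/seteqP; split=> t At i //; exact: At.
by apply: closed_bigI => i _; exact: Acl.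
Qed.

(** * The modulus on the complex numbers *)

Section Modulus.
Context (R : realType).
Implicit Types z w : R[i].

Lemma normcD_le z w : normc (z + w) <= normc z + normc w.
Proof. exact: le_normcD. Qed.

Lemma normc_opp z : normc (- z) = normc z.
Proof. exact: normcN. Qed.

Lemma normcB_ge z w : normc z - normc w <= normc (z - w).
Proof. by rewrite lerBlDr; apply: le_trans (normcD_le _ _); rewrite subrK. Qed.

Lemma normc_real (r : R) : 0 <= r -> normc r%:C = r.
Proof. by move=> r0; rewrite /= expr0n/= addr0 sqrtr_sqr ger0_norm. Qed.

Lemma normc_conj z : normc z^* = normc z.
Proof. by case: z => a b /=; rewrite sqrrN. Qed.

Lemma mulc_conj z : z^* * z = (normc z ^+ 2)%:C.
Proof. by rewrite mulrC -sqr_normc rmorphXn. Qed.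

(** The norm of [R[i]] takes values in [R[i]], so the radii in its metric are complex. A positive
    one has zero imaginary part, which allows real radii here. *)
Lemma cvgcP (T : Type) (F : set_system T) (FF : Filter F) (f : T -> R[i]) z :
  (forall e : R, 0 < e -> \forall t \near F, normc (z - f t) < e) ->
  f t @[t --> F] --> z.
Proof.
move=> fz; apply/cvgrPdist_lt => e; rewrite ltcE/= => /andP[/eqP e0 ep].
have -> : e = (complex.Re e)%:C by case: e e0 ep => a b /= -> _.
apply: filterS (fz _ ep) => t.
change (normc (z - f t) < complex.Re e ->
  (normc (z - f t))%:C < (complex.Re e)%:C).
by rewrite ltcR.
Qed.

Lemma nbhs_normc z (e : R) : 0 < e -> \forall w \near z, normc (z - w) < e.
Proof.
move=> e0; have e0' : 0 < e%:C by rewrite ltcR.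
have /cvgrPdist_lt/(_ _ e0') : w @[w --> z] --> z by exact: cvg_id.
apply: filterS => w.
by change ((normc (z - w))%:C < e%:C -> normc (z - w) < e); rewrite ltcR.
Qed.

Lemma normc_continuous : continuous (@normc R : R[i] -> R).
Proof.
move=> z; apply/(cvgrPdist_lt (FF := nbhs_filter z)) => e e0.
apply: filterS (nbhs_normc z e0) => w zw.
apply: le_lt_trans zw; rewrite ler_norml normcB_ge andbT lerNl opprB.
by rewrite -[leRHS]normc_opp opprB normcB_ge.
Qed.

Lemma conjc_continuous : continuous (@conjc R : R[i] -> R[i]).
Proof.
move=> z; apply: (@cvgcP _ _ (nbhs_filter z)) => e e0.
apply: filterS (nbhs_normc z e0) => w.
by rewrite -(normc_conj (z - w)) rmorphB.
Qed.

(** The disk is closed and lies in the continuous image of the compact square with side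
    [[-M, M]]. *)
Lemma compact_normc_le (M : R) : compact [set z : R[i] | normc z <= M].
Proof.
pose box := `[- M, M]%classic `*` `[- M, M]%classic.
pose c (p : R * R) : R[i] := p.1 +i* p.2.
have cc : continuous c.
  move=> [a b]; apply: cvgcP => e e0.
  have e2 : 0 < e / 2 by rewrite divr_gt0.
  have na : \forall p \near ((a, b) : R * R), `|a - p.1| < e / 2.
    have : p.1 @[p --> ((a, b) : R * R)] --> a by exact: cvg_fst.
    by move/cvgrPdist_lt/(_ _ e2).
  have nb : \forall p \near ((a, b) : R * R), `|b - p.2| < e / 2.
    have : p.2 @[p --> ((a, b) : R * R)] --> b by exact: cvg_snd.
    by move/cvgrPdist_lt/(_ _ e2).
  apply: filterS2 na nb => -[x y] xa yb.
  have -> : c (a, b) - c (x, y) = (a - x)%:C + (0 +i* (b - y)).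
    by apply/eqP; rewrite eq_complex/= addr0 add0r !eqxx.
  apply: le_lt_trans (normcD_le _ _) _.
  by rewrite /= !expr0n/= addr0 add0r !sqrtr_sqr; lra.
have /(continuous_compact (continuous_subspaceT cc)) : compact box.
  by apply: compact_setX; exact: segment_compact.
move=> boxc; apply: (subclosed_compact _ boxc).
  apply: (@preimage_closed _ _ _ [set x : R | x <= M]); last exact: closed_le.
  by move=> z _; exact: normc_continuous.
move=> [a b] /= abM; exists (a, b) => //.
have le (x y : R) : Num.sqrt (x ^+ 2 + y ^+ 2) <= M -> `|x| <= M.
  by apply: le_trans; rewrite -sqrtr_sqr ler_wsqrtr// lerDl sqr_ge0.
split; rewrite /= in_itv/= -ler_norml; first exact: le abM.
by rewrite addrC in abM; exact: le abM.
Qed.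

Lemma closed_normc_le (T : topologicalType) (f : T -> R[i]) (M : R) :
  continuous f -> closed [set t | normc (f t) <= M].
Proof.
move=> fc.
apply: (@preimage_closed _ _ (fun t => normc (f t)) [set x : R | x <= M]).
  by move=> t _; apply: continuous_comp; [exact: fc | exact: normc_continuous].
exact: closed_le.
Qed.

Lemma closed_normc_ge (T : topologicalType) (f : T -> R[i]) (M : R) :
  continuous f -> closed [set t | M <= normc (f t)].
Proof.
move=> fc.
apply: (@preimage_closed _ _ (fun t => normc (f t)) [set x : R | M <= x]).
  by move=> t _; apply: continuous_comp; [exact: fc | exact: normc_continuous].
exact: closed_ge.
Qed.

Lemma closed_eqc (T : topologicalType) (f g : T -> R[i]) :
  continuous f -> continuous g -> closed [set t | f t = g t].
Proof.
move=> fc gc; have -> : [set t | f t = g t] = [set t | normc (f t - g t) <= 0].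
  apply/seteqP; split=> t /= [fg]; first by rewrite fg subrr normc0.
  apply/eqP; rewrite -subr_eq0; apply/eqP/eq0_normc/eqP.
  by rewrite eq_le fg normc_ge0.
apply: closed_normc_le => t; apply: cvgB; [exact: fc | exact: gc].
Qed.

Lemma continuous_addc (T : topologicalType) (f g : T -> R[i]) :
  continuous f -> continuous g -> continuous (fun t => f t + g t).
Proof. by move=> fc gc t; apply: cvgD; [exact: fc | exact: gc]. Qed.

Lemma continuous_mulc (T : topologicalType) (f g : T -> R[i]) :
  continuous f -> continuous g -> continuous (fun t => f t * g t).
Proof. by move=> fc gc t; apply: cvgM; [exact: fc | exact: gc]. Qed.

End Modulus.

(** * The algebra of bounded continuous functions and its ideals *)

Section BoundedFunctions.
Context (R : realType) (X : topologicalType).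
Local Notation CBX := (CB R X).
Implicit Types f g u : CBX.

Lemma CB_ext f g : (forall x, f x = g x) -> f = g.
Proof. by move=> fg; apply/val_inj/funext. Qed.

Lemma CB_addE f g x : (f + g) x = f x + g x. Proof. by []. Qed.

Lemma CB_subE f g x : (f - g) x = f x - g x. Proof. by []. Qed.

Lemma CB_mulE f g x : (f * g) x = f x * g x. Proof. by []. Qed.

Lemma CB_scaleE (a : R[i]) f x : (a *: f) x = a * f x. Proof. by []. Qed.

Lemma CB_oneE x : (1 : CBX) x = 1. Proof. by []. Qed.

Lemma CB_continuous f : continuous f.
Proof. by have /set_mem[] := valP f. Qed.

Lemma CB_intro (f : X -> R[i]) (M : R) :
  continuous f -> (forall x, normc (f x) <= M) ->
  exists u : CBX, forall x, u x = f x.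
Proof.
move=> fc fM; have fP : f \in @bounded_continuous R X.
  by rewrite inE; split=> //; apply/bounded_funcP; exists M.
by exists (MkCB fP).
Qed.

Lemma CB_conj u : exists v : CBX, forall x, v x = (u x)^*.
Proof.
apply: (@CB_intro _ (supnorm u)) => x.
  apply: (@continuous_comp _ _ _ u (@conjc R)); first exact: CB_continuous.
  exact: conjc_continuous.
by rewrite normc_conj supnorm_ub.
Qed.

Lemma CB_inv u (d : R) : 0 < d -> (forall x, d <= normc (u x)) ->
  exists v : CBX, forall x, u x * v x = 1.
Proof.
move=> d0 du; have u0 x : u x != 0.
  by apply: contraTN (du x) => /eqP ->; rewrite normc0 -ltNge.
suff [v vE] : exists v : CBX, forall x, v x = (u x)^-1.
  by exists v => x; rewrite vE mulfV.
apply: (@CB_intro _ d^-1) => x.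
  by apply: (@continuousV _ _ u); [exact: u0 | exact: CB_continuous].
by rewrite normcV lef_pV2 ?posrE// (lt_le_trans d0 (du x)).
Qed.

Lemma closure_supnormP (A : set CBX) f :
  closure A f <-> forall e : R, 0 < e -> exists2 g, A g & supnorm (f - g) < e.
Proof.
split=> [Af e e0|Af B /(@nbhs_normP R[i] CBX)[e /= e0 eB]].
  have [|g [Ag fg]] := Af (fun g => `|f - g| < e%:C).
    by apply/(@nbhs_normP R[i] CBX); exists e%:C => //=; rewrite ltcR.
  by exists g => //; move: fg; rewrite CB_normE ltcR.
move: e0; rewrite ltcE/= => /andP[/eqP e0 ep].
have [g Ag fg] := Af _ ep; exists g; split=> //; apply: eB => /=.
rewrite CB_normE; move: fg; rewrite -ltcR.
by case: e e0 {ep} => a b /= ->.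
Qed.

Section IdealClosure.
Variable I : set CBX.
Hypothesis I_ideal : ideal I.

Lemma idealZ (a : R[i]) f : I f -> I (a *: f).
Proof.
have [_ _ IM] := I_ideal; move=> If.
have -> : a *: f = (a *: (1 : CBX) : CBX) * f.
  by apply: CB_ext => x; rewrite CB_mulE !CB_scaleE CB_oneE mulr1.
exact: IM.
Qed.

Lemma idealB f g : I f -> I g -> I (f - g).
Proof.
have [_ ID _] := I_ideal; move=> If Ig; apply: ID => //.
by rewrite -scaleN1r; exact: idealZ.
Qed.

Lemma ideal_sum (k : nat) (F : 'I_k -> CBX) :
  (forall i, I (F i)) -> I (\sum_(i < k) F i).
Proof.
by have [I0 ID _] := I_ideal; move=> IF; apply: (big_ind I).
Qed.

End IdealClosure.

Lemma ideal_generated_ideal (G : set CBX) : ideal (ideal_generated G).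
Proof.
split=> [|f g If Ig|a f If] J JG; have [[J0 JD JM] _] := JG => //.
  by apply: JD; [exact: If | exact: Ig].
by apply: JM; exact: If.
Qed.

End BoundedFunctions.

(** * Characters of the ideal and compactness *)

Section Characters.
Context (R : realType) (X : topologicalType) (H : set (CB R X)).
Hypothesis H_ideal : ideal H.
Local Notation CBX := (CB R X).

(** Being nonzero is not a closed condition. With the norm bound in its place, the set is closed in
    a product of disks; it also contains the zero functional. *)
Definition contractive_characters : set {ptws H -> R[i]} :=
  [set chi |
    [/\ forall f g h : H, \val h = \val f + \val g -> chi h = chi f + chi g,
        forall (a : R[i]) (f h : H), \val h = a *: \val f -> chi h = a * chi f,
        forall f g h : H, \val h = \val f * \val g -> chi h = chi f * chi g &
        forall f : H, normc (chi f) <= supnorm (\val f)]].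

Lemma character_eval_continuous (f : H) :
  continuous ((fun chi => chi f) : {ptws H -> R[i]} -> R[i]).
Proof. exact: (@proj_continuous H (fun=> R[i]) f). Qed.

Lemma closed_contractive_characters : closed contractive_characters.
Proof.
have -> : contractive_characters =
  [set chi | forall f g h : H,
    \val h = \val f + \val g -> chi h = chi f + chi g] `&`
  [set chi | forall (a : R[i]) (f h : H),
    \val h = a *: \val f -> chi h = a * chi f] `&`
  [set chi | forall f g h : H,
    \val h = \val f * \val g -> chi h = chi f * chi g] `&`
  [set chi | forall f : H, normc (chi f) <= supnorm (\val f)].
  by apply/seteqP; split=> [chi []|chi [[[]]]].
do !apply: closedI; do ?[apply: closed_forall => ?].
- apply: closed_eqc; first exact: character_eval_continuous.
  by apply: continuous_addc; exact: character_eval_continuous.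
- apply: closed_eqc; first exact: character_eval_continuous.
  apply: (@continuous_mulc _ _ (fun=> _)); last exact: character_eval_continuous.
  exact: cst_continuous.
- apply: closed_eqc; first exact: character_eval_continuous.
  by apply: continuous_mulc; exact: character_eval_continuous.
- by apply: closed_normc_le; exact: character_eval_continuous.
Qed.

Lemma compact_contractive_characters : compact contractive_characters.
Proof.
pose disk (f : H) := [set z : R[i] | normc z <= supnorm (\val f)].
have bc : @compact {ptws H -> R[i]} [set chi | forall f : H, disk f (chi f)].
  apply: (@tychonoff H (fun=> R[i]) disk) => f.
  exact: compact_normc_le.
apply: (subclosed_compact closed_contractive_characters bc).
by move=> chi [].
Qed.

Definition inH (f : CBX) (Hf : H f) : H := exist _ f (mem_set Hf).

(** If [|chi f| > |f|], then [p = f / chi f] has norm below 1 and [1 - p] has an inverse [v] in the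
    whole algebra. Multiplying [v = 1 + p v] by [p] gives the identity [v p = p + p (v p)] inside
    [H], and [chi p = 1] turns it into [0 = 1]. *)
Lemma gelfand_spectrum_contractive chi :
  gelfand_spectrum H chi -> contractive_characters chi.
Proof.
move=> [chiD chiZ chiM _]; split=> // f; rewrite leNgt; apply/negP => fchi.
set c := chi f in fchi.
have Hf : H (\val f) by exact: set_mem (valP f).
have [H0 HD HM] := H_ideal.
have nc0 : 0 < normc c by apply: le_lt_trans fchi; exact: supnorm_ge0.
have c0 : c != 0 by apply: contraTN nc0 => /eqP ->; rewrite normc0 ltxx.
pose p := c^-1 *: \val f.
have Hp : H p by exact: idealZ.
pose d := 1 - supnorm (\val f) / normc c.
have d0 : 0 < d by rewrite /d subr_gt0 ltr_pdivrMr ?mul1r.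
have [x|v vE] := @CB_inv _ _ (1 - p) d d0.
  rewrite CB_subE CB_oneE; apply: le_trans (normcB_ge _ _).
  rewrite normc1 /d lerD2l lerN2 CB_scaleE.
  by rewrite normcM normcV mulrC ler_pM2r ?invr_gt0// supnorm_ub.
have Hvp : H (v * p) by exact: HM.
have Hpvp : H (p * (v * p)) by exact: HM.
have chip : chi (inH Hp) = 1.
  by rewrite (chiZ c^-1 f) ?mulVf.
have : chi (inH Hvp) = chi (inH Hp) + chi (inH Hpvp).
  apply: chiD => /=; apply: CB_ext => x.
  have := vE x; rewrite CB_addE !CB_mulE CB_subE CB_oneE.
  by move=> uv1; rewrite -[X in _ = X + _]mulr1 -uv1; ring.
rewrite (chiM (inH Hp) (inH Hvp) (inH Hpvp)) // chip mul1r => /eqP.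
by rewrite -subr_eq subrr eq_sym oner_eq0.
Qed.

End Characters.
Arguments contractive_characters {R X} H.

(** * From countable generation to a sigma-compact spectrum *)

Section Generators.
Context (R : realType) (X : topologicalType) (H : set (CB R X)).
Hypotheses (H_ideal : ideal H) (H_closed : closed H).
Local Notation CBX := (CB R X).

Lemma closure_ideal_generated_sub (G : set CBX) :
  G `<=` H -> closure (ideal_generated G) `<=` H.
Proof.
move=> GH; rewrite [X in _ `<=` X](closure_id H).1//; apply: closure_subset.
exact: smallest_sub.
Qed.

Lemma spectrum_kernel_closed chi (G : set CBX) :
  gelfand_spectrum H chi -> G `<=` H ->
  (forall f : H, G (\val f) -> chi f = 0) ->
  forall f : H, closure (ideal_generated G) (\val f) -> chi f = 0.
Proof.
move=> chiP GH chiG f Gf.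
have [_ _ _ chi_le] := gelfand_spectrum_contractive H_ideal chiP.
have [chiD chiZ chiM [e e0]] := chiP.
have [H0 HD HM] := H_ideal.
pose J := [set g | exists2 h : H, chi h = 0 & \val h = g].
have Jideal : ideal J.
  split=> [|_ _ [g g0 <-] [h h0 <-]|a _ [h h0 <-]].
  - exists (inH H0) => //.
    by rewrite (chiZ 0 (inH H0)) ?mul0r//= scale0r.
  - have Hgh : H (\val g + \val h) by apply: HD; exact: set_mem (valP _).
    by exists (inH Hgh) => //; rewrite (chiD g h) ?g0 ?h0 ?addr0.
  - have Hh : H (\val h) by exact: set_mem (valP _).
    have He : H (\val e) by exact: set_mem (valP _).
    (* The multiplier [a] may lie outside [H], so [chi a] is meaningless. But [e (a h) = h (a e)] is
       a product within [H] on both sides, whence [chi e * chi (a h) = 0] with [chi e] nonzero. *)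
    have Hah := HM a _ Hh; have Hae := HM a _ He.
    have Hahe := HM (\val e) _ Hah.
    exists (inH Hah) => //; apply/eqP.
    rewrite -(mulIr_eq0 _ (mulIf e0)) mulrC -(chiM e _ (inH Hahe))//.
    rewrite (chiM h (inH Hae)) ?h0 ?mul0r//=.
    by rewrite mulrCA [RHS]mulrCA [X in a * X]mulrC.
have GJ : ideal_generated G `<=` J.
  apply: smallest_sub => // g Gg.
  by exists (inH (GH _ Gg)) => //; exact: chiG.
(* Passage to the closure: for [h] in the kernel, [|chi f| = |chi (f - h)| <= |f - h|], which can be
   made arbitrarily small. *)
apply: eq0_normc; apply/eqP; rewrite eq_le normc_ge0 andbT.
apply/ler_addgt0Pl => d d0; rewrite addr0.
have [g /GJ[h h0 <-] fg] := (closure_supnormP _ _).1 Gf _ d0.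
have Hf : H (\val f) by exact: set_mem (valP _).
have Hh : H (\val h) by exact: set_mem (valP _).
have Hfh := idealB H_ideal Hf Hh.
have -> : chi f = chi (inH Hfh) by rewrite (chiD (inH Hfh) h) ?h0 ?addr0//= subrK.
by apply: le_trans (chi_le (inH Hfh)) _; exact: ltW.
Qed.

Lemma sigma_compact_spectrum :
  sigma_generated H -> sigma_compact (gelfand_spectrum H).
Proof.
move=> [f HE].
have fH : range f `<=` H.
  rewrite HE => _ [n _ <-]; apply: subset_closure => J [_]; apply.
  by exists n.
pose h n := inH (fH _ (imageT f n)).
(* The compact pieces are indexed by codes of pairs: [n] selects a generator, [m] a lower bound for
   its value. A number that codes no pair gives the empty set. *)
pose K k := if @unpickle (nat * nat)%type k is Some (n, m) then
    contractive_characters H `&`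
    [set chi : {ptws H -> R[i]} | m.+1%:R^-1 <= normc (chi (h n))]
  else set0.
exists K => [k|].
  rewrite /K; case: unpickle => [[n m]|]; last exact: compact0.
  apply: subclosed_compact (@compact_contractive_characters _ _ H) _;
    last by move=> ? [].
  apply: closedI; first exact: closed_contractive_characters.
  by apply: closed_normc_ge; exact: character_eval_continuous.
apply/seteqP; split=> [chi chiP|chi [k _]].
  have [n chin] : exists n, chi (h n) != 0.
    apply: contrapT => /forallNP chif.
    have [_ _ _ [e /eqP]] := chiP; apply.
    apply: (spectrum_kernel_closed chiP fH); last first.
      by rewrite -HE; exact: set_mem (valP _).
    move=> g [n _ fng]; have -> : g = h n by exact: val_inj.
    by apply/eqP/negP => /negP; exact: chif.
  have nn : 0 < normc (chi (h n)).
    by rewrite lt_def normc_ge0 andbT; apply: contra_neq chin; exact: eq0_normc.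
  have [m] := ltr_add_invr nn; rewrite add0r => mn.
  exists (pickle (n, m)) => //; rewrite /K pickleK; split; last exact: ltW.
  exact: gelfand_spectrum_contractive.
(* The lower bound at [h n] excludes the zero functional. *)
rewrite /K; case: unpickle => [[n m]|//] [[chiD chiZ chiM _] mn]; split=> //.
exists (h n); apply: contraTN mn => /eqP ->.
by rewrite normc0 -ltNge invr_gt0.
Qed.

(** * From a sigma-compact spectrum to countable generation *)

(** Otherwise the closed sets of characters killing a given finite list, directed by concatenation
    of lists, would all meet [K]. A common point in [K] would be the zero functional. *)
Lemma compact_spectrum_nonvanishing (K : set {ptws H -> R[i]}) :
  compact K -> K `<=` gelfand_spectrum H ->
  exists s : seq H, forall chi, K chi -> exists2 h, h \in s & chi h != 0.
Proof.
move=> Kc Ksp; apply: contrapT => /forallNP noseq.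
pose C (s : seq H) := [set chi : {ptws H -> R[i]} |
  forall h, h \in s -> chi h = 0].
have [s|s1 s2|s|chi Kchi chi0] := compact_closed_directed (C := C) [::] Kc.
- do 2?[apply: closed_forall => ?]; apply: closed_eqc.
    exact: character_eval_continuous.
  exact: cst_continuous.
- exists (s1 ++ s2) => chi chi0.
  by split=> h hs; apply: chi0; rewrite mem_cat hs ?orbT.
- have /existsNP[chi /not_implyP[Kchi chis]] := noseq s.
  exists chi; split=> // h hs; apply: contrapT => /eqP chih.
  by apply: chis; exists h.
have [_ _ _ [h /eqP]] := Ksp _ Kchi; apply.
by apply: (chi0 [:: h]); rewrite inE.
Qed.

Definition eval_at (x : X) : {ptws H -> R[i]} := fun h => \val h x.

Lemma eval_at_contractive x : contractive_characters H (eval_at x).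
Proof.
split=> [f g h|a f h|f g h|f]; rewrite /eval_at; try by move=> ->.
exact: supnorm_ub.
Qed.

Lemma lower_bound_on_level_set (h : nat -> H) (f : H) (e : R) :
  (forall chi, gelfand_spectrum H chi -> exists n, chi (h n) != 0) -> 0 < e ->
  exists (k : nat) (d : R), 0 < d /\ forall x, e <= normc (\val f x) ->
    exists i : 'I_k, d <= normc (\val (h i) x).
Proof.
move=> hP e0; apply: contrapT => /forallNP nobound.
(* The same index controls how many [h i] are tested and how small they are, so the sets decrease
   with [k]. The condition on [f] keeps a common point nonzero. *)
pose C (k : nat) := [set chi : {ptws H -> R[i]} | e <= normc (chi f) /\
  forall i : nat, (i < k)%N -> normc (chi (h i)) <= k.+1%:R^-1].
have [k|k l|k|chi [chiD chiZ chiM _] chiC] := compact_closed_directed (C := C) 0%N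
    (@compact_contractive_characters _ _ H).
- apply: closedI.
    by apply: closed_normc_ge; exact: character_eval_continuous.
  do 2?[apply: closed_forall => ?]; apply: closed_normc_le.
  exact: character_eval_continuous.
- exists (maxn k l) => chi [ef hi].
  have hle (j : nat) : (j <= maxn k l)%N -> C j chi.
    move=> jkl; split=> // i ij; apply: le_trans (hi i (leq_trans ij jkl)) _.
    by rewrite lef_pV2 ?posrE// ler_nat.
  by split; apply: hle; rewrite ?leq_maxl ?leq_maxr.
(* Failure of the bound for [d = 1/(k+1)] yields a point [x] whose evaluation lies in [C k]. *)
- have /forallNP/(_ k.+1%:R^-1) := nobound k.
  rewrite invr_gt0 ltr0Sn => nb; have {nb} [//|] := (not_andP _ _).1 nb.
  move=> /existsNP[x /not_implyP[fx /forallNP nx]].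
  exists (eval_at x); split; first exact: eval_at_contractive.
  split=> // i ik; rewrite leNgt; apply/negP => /ltW.
  exact: (nx (Ordinal ik)).
have [|n chin] := hP chi.
  split=> //; exists f; have [+ _] := chiC 0%N.
  by apply: contraTN => /eqP ->; rewrite normc0 -ltNge.
have nn : 0 < normc (chi (h n)).
  by rewrite lt_def normc_ge0 andbT; apply: contra_neq chin; exact: eq0_normc.
have [m] := ltr_add_invr nn; rewrite add0r ltNge => /negP; apply.
(* This index exceeds [n], so [h n] is tested, and is at least [m], so the value is at most
   [1/(m+1)]. *)
have [_ /(_ n)] := chiC (maxn n.+1 m).
rewrite leq_maxl => /(_ isT) /le_trans; apply.
by rewrite lef_pV2 ?posrE// ler_nat ltnS leq_maxr.
Qed.

(* On [e <= |f|] the function [g] is at least [d ^+ 2], so that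
   [f - f * g / (g + eta) = f * eta / (g + eta)] is uniformly small. *)
Lemma spectrum_nonvanishing_generators (h : nat -> H) :
  (forall chi, gelfand_spectrum H chi -> exists n, chi (h n) != 0) ->
  H = closure (ideal_generated (range (fun n => \val (h n)))).
Proof.
move=> hP; apply/seteqP; split; last first.
  by apply: closure_ideal_generated_sub => _ [n _ <-]; exact: set_mem (valP _).
set I := ideal_generated _ => f Hf; apply/closure_supnormP => e0 e0_gt0.
(* A supremum of values at most [e] is only bounded by [e]; halving restores the strict
   inequality. *)
pose e := e0 / 2; have e_gt0 : 0 < e by rewrite divr_gt0.
have Iideal : ideal I := ideal_generated_ideal _.
have [_ _ IM] := Iideal.
have [k [d [d_gt0 hd]]] := lower_bound_on_level_set (inH Hf) hP e_gt0.
have [hc hcE] := choice (fun i : 'I_k => CB_conj (\val (h i))).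
(* Multiplying by conjugates keeps the sum of the [|h i|^2] in the ideal. *)
pose g := \sum_(i < k) hc i * \val (h i).
have Ig : I g.
  apply: ideal_sum => // i; apply: IM => J [_]; apply.
  by exists i.
pose r x := \sum_(i < k) normc (\val (h i) x) ^+ 2.
have gE x : g x = (r x)%:C.
  rewrite /g /r rmorph_sum/=.
  elim/big_ind2 : _ => //[u1 z1 u2 z2 <- <-//|i _].
  by rewrite CB_mulE hcE mulc_conj.
have r_ge0 x : 0 <= r x by apply: sumr_ge0 => i _; rewrite sqr_ge0.
have r_ge x : e <= normc (f x) -> d ^+ 2 <= r x.
  move=> /hd[i di]; rewrite /r (bigD1 i)//=.
  apply: (@le_trans _ _ (normc (\val (h i) x) ^+ 2)).
    by rewrite lerXn2r// nnegrE ?normc_ge0 ?ltW.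
  by rewrite lerDl sumr_ge0// => j _; rewrite sqr_ge0.
(* Chosen so that [(|f| + 1) * eta = e * d ^+ 2]; the added 1 keeps the denominator positive when
   [f = 0]. *)
pose eta := e * d ^+ 2 / (supnorm f + 1).
have f1 : 0 < supnorm f + 1 by rewrite ltr_wpDl ?supnorm_ge0.
have eta_gt0 : 0 < eta by rewrite divr_gt0// mulr_gt0// exprn_gt0.
pose c : CBX := eta%:C *: (1 : CBX).
have gcE x : (g + c) x = (r x + eta)%:C.
  by rewrite CB_addE gE CB_scaleE CB_oneE mulr1 rmorphD.
have [x|v vE] := @CB_inv _ _ (g + c) eta eta_gt0.
  by rewrite gcE normc_real ?addr_ge0 ?(ltW eta_gt0)// lerDr.
exists (f * v * g); first exact: IM.
apply: (@le_lt_trans _ _ e); last by rewrite /e; lra.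
apply: supnorm_le => [|x]; first exact: ltW.
have {}vE : (g x + eta%:C) * v x = 1.
  by have := vE x; rewrite CB_addE CB_scaleE CB_oneE mulr1.
have -> : (f - f * v * g) x = f x * (eta%:C * v x).
  by rewrite CB_subE !CB_mulE -[X in X - _]mulr1 -vE; ring.
have nv : (r x + eta) * normc (v x) = 1.
  rewrite -(@normc_real _ (r x + eta)) ?addr_ge0 ?(ltW eta_gt0)//.
  by rewrite -normcM rmorphD/= -gE vE normc1.
rewrite !normcM normc_real ?(ltW eta_gt0)//.
have v_ge0 := normc_ge0 (v x).
(* Writing [e] as [e * (r x + eta) * |v x|] lets [|v x|] cancel. What remains is
   [|f x| * eta <= e * (r x + eta)]: by [r x >= d ^+ 2] where [|f x| >= e], and trivially
   elsewhere. *)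
rewrite -[leRHS]mulr1 -nv.
have [/r_ge drx|fe] := leP e (normc (f x)).
  apply: (@le_trans _ _ ((supnorm f + 1) * (eta * normc (v x)))).
    apply: ler_wpM2r; first by rewrite mulr_ge0 ?(ltW eta_gt0).
    by apply: le_trans (supnorm_ub f x) _; rewrite lerDl.
  rewrite mulrA [(_ + 1) * eta]mulrC divfK ?gt_eqF// -mulrA ler_pM2l//.
  by apply: ler_wpM2r => //; apply: le_trans drx _; rewrite lerDl ltW.
apply: ler_pM; [exact: normc_ge0| |exact: ltW|].
  by rewrite mulr_ge0 ?(ltW eta_gt0).
by apply: ler_wpM2r => //; rewrite lerDr.
Qed.

End Generators.

Theorem theorem3p2p8 (R : realType) (X : topologicalType)
    (X_completely_regular : completely_regular_space X)
    (X_hausdorff : hausdorff_space X)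
    (H : set (CB R X))
    (H_ideal : ideal H) (H_closed : closed H) (H_nv : non_vanishing H) :
  sigma_compact (gelfand_spectrum H) <-> sigma_generated H.
Proof.
split; last exact: sigma_compact_spectrum.
move=> [K Kc HK]; have [H0 _ _] := H_ideal.
have Ksp n : K n `<=` gelfand_spectrum H by rewrite HK; exact: bigcup_sup.
have [s sP] := choice (fun n => compact_spectrum_nonvanishing (Kc n) (@Ksp n)).
(* One sequence runs through the entries of all the finite lists [s n]; the zero function fills the
   remaining places. *)
pose h k := if @unpickle (nat * nat)%type k is Some (n, i)
  then nth (inH H0) (s n) i else inH H0.
exists (fun n => \val (h n)).
apply: spectrum_nonvanishing_generators => // chi; rewrite HK => -[n _ Kchi].
have [g gs chig] := sP n chi Kchi.
by exists (pickle (n, index g (s n))); rewrite /h pickleK nth_index.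
Qed.
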